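(* Let $A$ be a finite alphabet and $\{F_a:a\in A\}$ a Möbius iterative system. Then there is no interval almost cover $\mathcal{W}=\{W_a:a\in A\}$ and no subshift $\Sigma\subseteq A^\omega$ compatible with $\mathcal{W}$ simultaneously satisfying: 1. $Q(\mathcal{W},\Sigma)<1$; 2. $\Sigma_{\mathcal{W}}$ is a Möbius number system for $\{F_a:a\in A\}$; 3. for every $w\in\Sigma_{\mathcal{W}}$, $\bigcap_{k=1}^\infty\overline{W_{w_{[0,k)}}}=\{\Phi(w)\}$.
   Context: $\mathbb{T}$ is the unit circle in $\mathbb{C}$. A disc preserving Möbius transformation is a map $F(z)=\frac{\alpha z+\beta}{\overline\beta z+\overline\alpha}$ with $|\alpha|^2-|\beta|^2=1$. Put $F^{\bullet}(x)=|F'(x)|$. Words: $A^*$ is the set of finite words over $A$ (including the empty word $\lambda$), $A^\omega$ the set of one-sided infinite words with the product topology; $w_{[0,n)}=w_0\cdots w_{n-1}$. A subshift is a closed set $\Sigma\subseteq A^\omega$ with $\sigma(\Sigma)\subseteq\Sigma$, where $\sigma(w)_i=w_{i+1}$. $\mathcal{L}(\Sigma)$ is the set of all finite words that are factors of some $w\in\Sigma$. A Möbius iterative system is a family $\{F_a:a\in A\}$ of disc preserving Möbius transformations. For $v=v_0\cdots v_{n-1}$ put $F_v=F_{v_0}\circ\cdots\circ F_{v_{n-1}}$ ($F_\lambda=\mathrm{id}$). A sequence $\{G_n\}$ of disc preserving Möbius transformations represents $x\in\mathbb{T}$ if $G_n\mu\to\delta_x$ weakly$^*$, where $\mu$ is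 the uniform probability measure on $\mathbb{T}$ and $G\mu(E)=\mu(G^{-1}(E))$. For $w\in A^\omega$, $\Phi(w)$ is the point $x\in\mathbb{T}$ represented by $\{F_{w_{[0,n)}}\}_{n=1}^\infty$ if it exists, and is undefined otherwise. A subshift $\Sigma'\subseteq A^\omega$ is a Möbius number system for $\{F_a\}$ if $\Phi$ is defined on all of $\Sigma'$, $\Phi(\Sigma')=\mathbb{T}$ and $\Phi|_{\Sigma'}$ is continuous. An interval almost cover is a family $\mathcal{W}=\{W_a:a\in A\}$ where each $W_a$ is a union of finitely many (possibly zero) open intervals on $\mathbb{T}$ and $\bigcup_{a\in A}\overline{W_a}=\mathbb{T}$. Refined sets: $W_\lambda=\mathbb{T}$ and $W_u=W_{u_0}\cap F_{u_0}(W_{u_1})\cap\cdots\cap F_{u_{[0,n-1)}}(W_{u_{n-1}})$ for $u$ of length $n\geq1$. A nonempty subshift $\Sigma$ is compatible with $\mathcal{W}$ if for every $v\in\mathcal{L}(\Sigma)$, $\overline{W_v}=\bigcup_{a\in A,\,va\in\mathcal{L}(\Sigma)}\overline{W_{va}}$. The interval shift is $\Sigma_{\mathcal{W}}=\{w\in\Sigma:\forall n,\ W_{w_{[0,n)}}\ne\emptyset\}$ (a subshift). Put $q(u)=\min\{(F_u^{-1})^{\bullet}(x):x\in\overline{W_u}\}$, $Q_n(\mathcal{W},\Sigma)=\min\{q(u):u\in\mathcal{L}(\Sigma_{\mathcal{W}}),\,|u|=n\}$ and $Q(\mathcal{W},\Sigma)=\lim_{n\to\infty}\sqrt[n]{Q_n(\mathcal{W},\Sigma)}$;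 this limit exists and equals $\sup_n\sqrt[n]{Q_n(\mathcal{W},\Sigma)}$, since $Q_{n+m}\ge Q_nQ_m$. *)

(* Defs.v *)
From HB Require Import structures.
From mathcomp Require Import all_boot all_order all_algebra.
From mathcomp Require Import all_classical all_reals all_analysis.
From mathcomp Require Import complex.
From mathcomp Require Import ring.

Set Implicit Arguments.
Unset Strict Implicit.
Unset Printing Implicit Defensive.

Import Order.TTheory GRing.Theory Num.Theory numFieldNormedType.Exports.

Local Open Scope classical_set_scope.
Local Open Scope ring_scope.

(* Keyed on [complex] so that the topology of the complex plane (the one every
   numFieldType carries) and its Borel sigma-algebra are found on R[i]. *)
HB.instance Definition _ (R : realType) := NormedModule.copy R[i] R[i]^o.
HB.instance Definition _ (R : realType) :=
  Measurable.copy R[i] (g_sigma_algebraType (@open R[i])).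

Section Circle.
Context {R : realType}.

Definition circle : set R[i] := [set z | `|z| = 1].

Definition expi (t : R) : R[i] := (cos t +i* sin t)%C.

(* Positively oriented; empty if t <= s, all of the circle if t - s > 2 pi. *)
Definition open_arc (s t : R) : set R[i] := expi @` `]s, t[%classic.

Definition finite_union_arcs (W : set R[i]) :=
  exists s : seq (R * R), W = \bigcup_(p in [set` s]) open_arc p.1 p.2.

Lemma pi2_gt0 : 0 < pi *+ 2 :> R.
Proof. by rewrite mulrn_wgt0 // pi_gt0. Qed.

Definition uniform_circle : set R[i] -> \bar R :=
  pushforward (uniform_prob pi2_gt0) expi.

Definition weakstar_cvg (m : nat -> set R[i] -> \bar R) (l : set R[i] -> \bar R)
  :=
  forall f : R[i] -> R, {within circle, continuous f} ->
    (\int[m n]_(z in circle) (f z)%:E)%E @[n --> \oo]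
      --> (\int[l]_(z in circle) (f z)%:E)%E.

End Circle.

Section MobiusAlgebra.
Context {C : numClosedFieldType}.
Implicit Types a b c d z : C.

Let den_neq0 a b z :
  `|a| ^+ 2 - `|b| ^+ 2 = 1 -> `|z| <= 1 -> b^* * z + a^* != 0.
Proof.
move=> ab z1; apply/eqP => /eqP; rewrite addrC addr_eq0 => /eqP e.
have : `|a| <= `|b|.
  by rewrite -(norm_conjC a) e normrN normrM norm_conjC ler_piMr.
rewrite -(ler_pXn2r (n := 2)) ?nnegrE // -subr_ge0 -opprB ab oppr_ge0.
by rewrite ler10.
Qed.

Lemma mob_algP a b c d :
  `|a| ^+ 2 - `|b| ^+ 2 = 1 -> `|c| ^+ 2 - `|d| ^+ 2 = 1 ->
  `|a * c + b * d^*| ^+ 2 - `|a * d + b * c^*| ^+ 2 = 1.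
Proof.
move=> ab cd; have := congr2 *%R ab cd; rewrite mulr1 => <-.
by rewrite !normCK !rmorphD !rmorphM /= !conjCK; ring.
Qed.

Let norm_le1 a b z : `|a| ^+ 2 - `|b| ^+ 2 = 1 -> `|z| <= 1 ->
  `|(a * z + b) / (b^* * z + a^*)| <= 1.
Proof.
move=> ab z1; have d0 := den_neq0 ab z1.
rewrite normf_div ler_pdivrMr ?normr_gt0 // mul1r.
rewrite -(ler_pXn2r (n := 2)) ?nnegrE // -subr_ge0.
suff -> : `|b^* * z + a^*| ^+ 2 - `|a * z + b| ^+ 2 = 1 - `|z| ^+ 2.
  by rewrite subr_ge0 exprn_ile1.
rewrite -[in RHS](mul1r (`|z| ^+ 2)) -ab.
by rewrite !normCK !rmorphD !rmorphM /= !conjCK; ring.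
Qed.

Lemma mob_alg_comp a b c d z :
  `|a| ^+ 2 - `|b| ^+ 2 = 1 -> `|c| ^+ 2 - `|d| ^+ 2 = 1 -> `|z| <= 1 ->
  ((a * c + b * d^*) * z + (a * d + b * c^*))
    / ((a * d + b * c^*)^* * z + (a * c + b * d^*)^*)
  = (a * ((c * z + d) / (d^* * z + c^*)) + b)
    / (b^* * ((c * z + d) / (d^* * z + c^*)) + a^*).
Proof.
move=> ab cd z1.
have n0 := den_neq0 cd z1.
have m0 := den_neq0 ab (norm_le1 cd z1).
have k0 := den_neq0 (mob_algP ab cd) z1.
move: k0; rewrite !rmorphD !rmorphM /= !conjCK => k0.
field; apply/andP; split => //; move: k0; apply: contra_neq => <-; ring.
Qed.

Lemma mob_alg_inv a b z : `|a| ^+ 2 - `|b| ^+ 2 = 1 -> `|z| <= 1 ->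
  (a^* * ((a * z + b) / (b^* * z + a^*)) + - b)
    / ((- b)^* * ((a * z + b) / (b^* * z + a^*)) + a^*^*) = z.
Proof.
move=> ab z1; have n0 := den_neq0 ab z1.
have ab1 : a * a^* - b * b^* = 1 by rewrite -!normCK.
have e : (- b)^* * ((a * z + b) / (b^* * z + a^*)) + a^*^*
         = (b^* * z + a^*)^-1.
  by rewrite rmorphN /= conjCK -[in RHS](mul1r _^-1) -ab1; field.
by rewrite e invrK -[RHS]mulr1 -ab1; field.
Qed.

End MobiusAlgebra.

Section Mobius.
Context {R : realType}.

(* Disc preserving Moebius transformations, given by their coefficients; the
   pairs (alpha, beta) and (- alpha, - beta) give the same map.  The pole is
   outside the closed unit disc, so the convention x / 0 = 0 never matters. *)
Record mobius := Mobius {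
  mob_a : R[i];
  mob_b : R[i];
  mob_det : `|mob_a| ^+ 2 - `|mob_b| ^+ 2 = 1 }.

Definition mob_fun (M : mobius) (z : R[i]) : R[i] :=
  (mob_a M * z + mob_b M) / ((mob_b M)^* * z + (mob_a M)^*).

Coercion mob_fun : mobius >-> Funclass.

Lemma mob_id_det : `|1 : R[i]| ^+ 2 - `|0 : R[i]| ^+ 2 = 1.
Proof. by rewrite normr1 normr0 expr1n expr0n subr0. Qed.

Definition mob_id := Mobius mob_id_det.

Definition mob_comp (M N : mobius) :=
  Mobius (mob_algP (mob_det M) (mob_det N)).

Lemma mob_inv_det (M : mobius) : `|(mob_a M)^*| ^+ 2 - `|- mob_b M| ^+ 2 = 1.
Proof. by rewrite norm_conjC normrN mob_det. Qed.

Definition mob_inv (M : mobius) := Mobius (mob_inv_det M).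

Lemma mob_fun_id (z : R[i]) : mob_id z = z.
Proof.
by rewrite /mob_fun /= rmorph0 rmorph1 mul1r mul0r addr0 add0r divr1.
Qed.

Lemma mob_fun_comp (M N : mobius) (z : R[i]) :
  `|z| <= 1 -> mob_comp M N z = M (N z).
Proof. exact: mob_alg_comp (mob_det M) (mob_det N). Qed.

Lemma mob_fun_inv (M : mobius) (z : R[i]) :
  `|z| <= 1 -> mob_inv M (M z) = z.
Proof. exact: mob_alg_inv (mob_det M). Qed.

End Mobius.
Arguments mobius : clear implicits.

Section Words.
Context {A : finType}.

Notation iword := {ptws nat -> discrete_topology A}.

Definition shift_word (w : iword) : iword := fun i => w i.+1.

Definition prefix_word (w : iword) (n : nat) : seq A := mkseq w n.

Definition subshift (S : set iword) :=
  closed S /\ forall w, S w -> S (shift_word w).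

Definition lang (S : set iword) : set (seq A) :=
  [set u | exists w, S w /\ exists i, u = mkseq (fun j => w (i + j)%N) (size u)].

End Words.

Notation "A ^ω" := {ptws nat -> discrete_topology A}
  (at level 2, format "A ^ω") : type_scope.

Section Systems.
Context {R : realType} {A : finType}.
Variable F : A -> mobius R.

Definition mob_word (v : seq A) : mobius R :=
  foldr (fun a M => mob_comp (F a) M) mob_id v.

Definition represents (G : nat -> mobius R) (x : R[i]) :=
  circle x /\ weakstar_cvg (fun n => pushforward uniform_circle (G n)) \d_x.

Definition Phi_rel (w : A^ω) (x : R[i]) :=
  represents (fun n => mob_word (prefix_word w n)) x.

(* The value 1 outside of the domain of definition is a dummy. *)
Definition Phi (w : A^ω) : R[i] := xget 1 (Phi_rel w).

Definition mobius_number_system (S : set A^ω) :=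
  [/\ subshift S,
      forall w, S w -> exists x, Phi_rel w x,
      Phi @` S = circle
    & {within S, continuous Phi}].

Variable W : A -> set R[i].

Definition interval_almost_cover :=
  (forall a, finite_union_arcs (W a)) /\ \bigcup_a closure (W a) = circle.

(* The factor [circle] only matters for the empty word. *)
Definition refined (u : seq A) : set R[i] :=
  circle `&` \bigcap_(i in [set: 'I_(size u)])
               mob_word (take i u) @` W (tnth (in_tuple u) i).

Variable S : set A^ω.

Definition compatible :=
  [/\ subshift S, S !=set0
    & forall v, lang S v ->
        closure (refined v) =
        \bigcup_(a in [set a | lang S (rcons v a)]) closure (refined (rcons v a))].

Definition interval_shift : set A^ω :=
  [set w | S w /\ forall n, refined (prefix_word w n) !=set0].

Definition bullet (M : mobius R) (x : R[i]) : R :=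
  ComplexField.Normc.normc (derive1 M x).

(* When the interval shift is nonempty and u is in its language, the infima in
   [q_word] and [Q_n] are minima: those of a continuous function on a nonempty
   compact set and of a nonempty finite set of reals. *)
Definition q_word (u : seq A) : R :=
  inf [set bullet (mob_inv (mob_word u)) x | x in closure (refined u)].

Definition Q_n (n : nat) : R :=
  inf [set q_word u | u in [set u | lang interval_shift u /\ size u = n]].

Definition Q : R := limn (fun n => Q_n n `^ n%:R^-1).

End Systems.

(* Main.v *)
Require Import Defs.
From mathcomp Require Import all_boot all_order all_algebra.
From mathcomp Require Import all_classical all_reals all_analysis.
From mathcomp Require Import complex measurable_realfun.
From mathcomp Require Import ring lra.

(** Let G_k be the composition of the maps of the first k letters of a word.
For a map M with coefficients (a, b) put d_M(x) = a - conj(b) x. Then the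
derivative of M^-1 at a point x of the circle has modulus |d_M(x)|^-2, and
d_{MN}(x) = d_M(x) d_N(M^-1 x) is the chain rule. So q(u) small means that
|d| is large somewhere on the closure of the refined set of u.

The heart of the matter is that no sequence (G_k) which represents x can have
derivatives (G_k^-1)'(x) bounded by r^k with r < 1
([contracting_not_represents]). In the half-plane model of the disc where x is
the point at infinity, the height of G_k(0) is the derivative of G_k^-1 at x.
The hyperbolic distance from G_k(0) to G_{k+1}(0) is bounded, so the horizontal
displacement at step k is at most a constant times the height, that is
O(r^k). These displacements are summable, G_k(0) converges to a finite point of
the boundary, and it cannot tend to infinity, that is to x. Concretely
conj(b_k) / d_k plays the role of the horizontal coordinate, and its boundedness
makes G_k^-1 contract a fixed neighbourhood of x, which leaves a fixed share of
the mass of G_k mu away from x.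

Compactness turns this into a statement about finite words. If, for some r < 1,
there were arbitrarily long words of the interval shift together with points of
the closures of their refined sets at which all prefixes u have derivative at
most r^|u|, a limit would give an infinite word w of the interval shift and a
point x common to all the closures, hence x = Phi(w), contradicting the above.
So there is a length L such that at every such point some prefix of length
between 1 and L expands more than r^length ([expanding_time]). Cutting off such
prefixes repeatedly gives q(u) >= c r^|u| with c > 0 independent of u
([uniform_expansion]).

Finally the n-th roots of Q_n do converge, by Fekete's lemma applied to
Q_{m+n} >= Q_m Q_n, and the limit Q is at least every r < 1, so Q >= 1
([Q_ge1]). *)
Set Implicit Arguments.
Unset Strict Implicit.
Unset Printing Implicit Defensive.

Import Order.TTheory GRing.Theory Num.Theory numFieldNormedType.Exports.
Import ComplexField.Normc.

Local Open Scope classical_set_scope.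
Local Open Scope ring_scope.

(** * Roots of supermultiplicative sequences *)

(** Fekete's lemma: the limit is the supremum. If m almost realizes the
supremum, writing n = q m + r gives v n >= q v m + v r, and v r is bounded. *)
Lemma superadditive_cvg (R : realType) (v : nat -> R) (B : R) :
  (forall m n, v m + v n <= v (m + n)%N) ->
  (forall n, `|v n| <= B * n%:R) ->
  cvgn (fun n => v n / n%:R).
Proof.
move=> vD vB.
have v0 : v 0 = 0.
  by apply/eqP; rewrite -normr_le0; have := vB 0%N; rewrite mulr0.
have B0 : 0 <= B by have := le_trans (normr_ge0 _) (vB 1%N); rewrite mulr1.
have vM q m : q%:R * v m <= v (q * m)%N.
  elim: q => [|q IH]; first by rewrite mul0r mul0n v0.
  by rewrite mulSn -natr1 mulrDl mul1r addrC (le_trans _ (vD _ _)) // lerD2l.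
pose E := [set v n.+1 / n.+1%:R | n in [set: nat]].
have ltnS0 n : 0 < n.+1%:R :> R by rewrite ltr0n.
have supE : has_sup E.
  split; first by exists (v 1%N / 1%:R); exists 0%N.
  exists B => _ [n _ <-]; rewrite ler_pdivrMr //.
  exact: le_trans (ler_norm _) (vB _).
apply/cvg_ex; exists (sup E); apply/cvgrPdist_le => e e0.
have e20 : 0 < e / 2 by rewrite divr_gt0.
(* The supremum is taken over n.+1 because v 0 / 0 is the dummy value 0. *)
have [_ [m0 _ <-] hm] := sup_adherent e20 supE.
set m := m0.+1 in hm; set t := v m / m%:R in hm.
have tB : `|t| <= B.
  by rewrite /t normrM normfV normr_nat ler_pdivrMr //; exact: vB.
near=> n.
have n0 : (0 < n)%N by near: n; exists 1%N.
have nR : 0 < n%:R :> R by rewrite ltr0n.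
have up : v n / n%:R <= sup E.
  by apply: ub_le_sup; [case: supE | exists n.-1 => //; rewrite prednK].
have big : 2 * B * m%:R <= e / 2 * n%:R.
  have : 2 * B * m%:R / (e / 2) <= n%:R by near: n; exact: nbhs_infty_ger.
  by rewrite ler_pdivrMr // [n%:R * _]mulrC.
have nE := divn_eq n m.
have lo : (t - e / 2) * n%:R <= v n.
  have h1 : (n %/ m)%:R * v m - B * (n %% m)%:R <= v n.
    rewrite {3}nE (le_trans _ (vD _ _)) // lerD ?vM //.
    by have := vB (n %% m)%N; rewrite ler_norml => /andP[].
  have vm : v m = t * m%:R by rewrite /t divfK // gt_eqF.
  have nER : n%:R = (n %/ m)%:R * m%:R + (n %% m)%:R :> R.
    by rewrite {1}nE natrD natrM.
  have r0 : 0 <= (n %% m)%:R :> R by rewrite ler0n.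
  have rm : (n %% m)%:R <= m%:R :> R by rewrite ler_nat ltnW // ltn_pmod.
  have [tB1 tB2] : - B <= t /\ t <= B by move: tB; rewrite ler_norml => /andP[].
  have h2 : (t + B) * (n %% m)%:R <= (2 * B) * m%:R.
    apply: ler_pM => //; lra.
  rewrite vm in h1.
  have e1 : t * n%:R = (n %/ m)%:R * (t * m%:R) + t * (n %% m)%:R.
    by rewrite nER; ring.
  rewrite mulrBl e1; lra.
rewrite -ler_pdivlMr // in lo.
rewrite ger0_norm ?subr_ge0 //.
lra.
Unshelve. all: by end_near.
Qed.

Lemma supermultiplicative_root_cvg (R : realType) (a : nat -> R) (K : R) :
  0 < K ->
  (forall m n, a m * a n <= a (m + n)%N) ->
  (forall n, K ^- n <= a n <= K ^+ n) ->
  cvgn (fun n => a n `^ n%:R^-1).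
Proof.
move=> K0 aM aK.
have a0 n : 0 < a n.
  by have /andP[h _] := aK n; apply: lt_le_trans h; rewrite invr_gt0 exprn_gt0.
have : cvgn (fun n => ln (a n) / n%:R).
  apply: (@superadditive_cvg _ _ `|ln K|) => [m n|n].
    by rewrite -lnM ?posrE // ler_ln ?posrE ?mulr_gt0.
  have /andP[h1 h2] := aK n.
  rewrite -[n%:R]normr_nat -normrM mulr_natr -lnXn // ler_norml; apply/andP.
  have hK : ln (a n) <= ln (K ^+ n) by rewrite ler_ln ?posrE ?exprn_gt0.
  have hK' : - ln (K ^+ n) <= ln (a n).
    by rewrite -lnV ?posrE ?exprn_gt0 // ler_ln ?posrE ?invr_gt0 ?exprn_gt0.
  by case: (ler0P (ln (K ^+ n))); split; lra.
move=> /cvg_ex [l vl]; apply/cvg_ex; exists (expR l).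
have := cvg_comp _ _ vl (@continuous_expR R l).
apply: cvg_trans; apply: near_eq_cvg; near=> n => /=.
by rewrite /powR gt_eqF // mulrC.
Unshelve. all: by end_near.
Qed.

(** * Modulus and topology of the complex plane *)

Section ModulusTopology.
Context {R : realType}.
Implicit Types (x y z : R[i]) (A B : set R[i]).

Lemma normE z : `|z| = (normc z)%:C%C.
Proof. by []. Qed.

Lemma normc_ge0 z : 0 <= normc z.
Proof. by case: z => a b; exact: sqrtr_ge0. Qed.

Lemma normc_gt0 z : (0 < normc z) = (z != 0).
Proof. by rewrite -ltcR -normE normr_gt0. Qed.

Lemma normc_conj z : normc z^* = normc z.
Proof. by apply: complexI; rewrite -!normE norm_conjC. Qed.

Lemma normc_le_dist z x : normc z <= normc x + normc (x - z).
Proof.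
by rewrite -lecR rmorphD /= -!normE -{1}(subrK x z) distrC addrC ler_normD.
Qed.

Lemma normc_distC x z : normc (x - z) = normc (z - x).
Proof. by apply: complexI; rewrite -!normE distrC. Qed.

(** The norm of R[i] takes its values in R[i]; this is convergence with a real
radius and a real distance. *)
Lemma cvgCP {T : Type} {F : set_system T} {FF : Filter F} (f : T -> R[i]) l :
  f @ F --> l <-> forall e : R, 0 < e -> \forall x \near F, normc (l - f x) < e.
Proof.
split=> [/cvgrPdist_lt h e e0|h].
  have e0' : 0 < e%:C%C :> R[i] by rewrite ltcR.
  by apply: filterS (h _ e0') => x; rewrite normE ltcR.
apply/cvgrPdist_lt => e e0; have [r er] : exists r, e = r%:C%C.
  by exists (complex.Re e); rewrite RRe_real // gtr0_real.
move: e0; rewrite er ltcR => /h; apply: filterS => x.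
by rewrite normE ltcR.
Qed.

Lemma nbhs_dist x (e : R) : 0 < e -> nbhs x [set y | normc (x - y) < e].
Proof. by have /cvgCP := @cvg_id _ (nbhs x); apply. Qed.

Lemma closure_image_sub (f : R[i] -> R[i]) A B x :
  f y @[y --> x] --> f x -> (forall y, A y -> B (f y)) ->
  closure A x -> closure B (f x).
Proof.
by move=> cf AB clA U /cf /clA [y [/AB By Uy]]; exists (f y).
Qed.

Lemma continuous_dist (x : R[i]) : continuous (fun z => normc (z - x)).
Proof.
move=> z; apply/(@cvgrPdist_lt _ _ _ _ (nbhs_filter z)) => e e0.
apply: filterS (nbhs_dist z e0) => y yz.
apply: le_lt_trans yz; rewrite ler_norml; apply/andP; split.
  have := normc_le_dist (y - x) (z - x).
  have -> : z - x - (y - x) = z - y by ring.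
  lra.
have := normc_le_dist (z - x) (y - x).
have -> : y - x - (z - x) = y - z by ring.
rewrite (normc_distC y z); lra.
Qed.

End ModulusTopology.

Section MobiusGeometry.
Context {R : realType}.
Implicit Types (M N : mobius R) (x y z : R[i]).

(** The denominator of the inverse of M. Its modulus to the power -2 is both the
derivative of the inverse of M at z and the density at z of the image under M of
the uniform measure. *)
Definition den M z := mob_a M - (mob_b M)^* * z.

Lemma mob_invE M z : mob_inv M z = ((mob_a M)^* * z - mob_b M) / den M z.
Proof.
by rewrite /mob_fun /= rmorphN /= conjCK mulNr /den [X in _ / X]addrC.
Qed.

Lemma mob_detC M : mob_a M * (mob_a M)^* - mob_b M * (mob_b M)^* = 1.
Proof. by rewrite -!normCK mob_det. Qed.

Lemma circle_conj z : circle z -> z * z^* = 1.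
Proof. by rewrite /circle /= => z1; rewrite -normCK z1 expr1n. Qed.

Lemma normc_circle z : circle z -> normc z = 1.
Proof. by rewrite /circle /= => z1; apply: complexI; rewrite -normE z1. Qed.

Lemma circle_le1 z : circle z -> `|z| <= 1.
Proof. by rewrite /circle /= => ->. Qed.

Lemma mob_bC_lt_a M : normc (mob_b M) < normc (mob_a M).
Proof.
rewrite -ltcR -!normE -(ltr_pXn2r (n := 2)) ?nnegrE // -subr_gt0 mob_det.
exact: ltr01.
Qed.

Lemma den_gt0 M z : circle z -> 0 < normc (den M z).
Proof.
move=> z1; have := normc_le_dist (mob_a M) ((mob_b M)^* * z).
have -> : normc ((mob_b M)^* * z) = normc (mob_b M).
  by rewrite normcM (normc_circle z1) mulr1 normc_conj.
rewrite normc_distC -/(den M z); have := mob_bC_lt_a M; lra.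
Qed.

Lemma den_neq0 M z : circle z -> den M z != 0.
Proof. by move=> z1; rewrite -normc_gt0 den_gt0. Qed.

Lemma circle_mob_inv M z : circle z -> circle (mob_inv M z).
Proof.
move=> z1; have zz := circle_conj z1; have d0 := den_neq0 M z1.
rewrite /circle /= mob_invE.
have -> : (mob_a M)^* * z - mob_b M = z * (den M z)^*.
  rewrite /den rmorphB rmorphM /= conjCK mulrBr.
  have -> : z * (mob_b M * z^*) = mob_b M * (z * z^*) by ring.
  by rewrite zz mulr1 mulrC.
by rewrite normf_div normrM norm_conjC z1 mul1r divff // normr_eq0.
Qed.

Lemma mob_invK_fun M : mob_inv (mob_inv M) =1 M.
Proof. by move=> z; rewrite /mob_fun /= opprK conjCK. Qed.

Lemma circle_mob M z : circle z -> circle (M z).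
Proof. by move=> z1; rewrite -mob_invK_fun; exact: circle_mob_inv. Qed.

Lemma mobK M z : circle z -> mob_inv M (M z) = z.
Proof. by move=> z1; rewrite mob_fun_inv // circle_le1. Qed.

Lemma mob_compE M N z : circle z -> mob_comp M N z = M (N z).
Proof. by move=> z1; rewrite mob_fun_comp // circle_le1. Qed.

Lemma den_comp M N z : circle z ->
  den (mob_comp M N) z = den M z * den N (mob_inv M z).
Proof.
move=> z1; have d0 := den_neq0 M z1.
rewrite mob_invE {3}/den /= mulrBr.
have -> : den M z * ((mob_b N)^* * (((mob_a M)^* * z - mob_b M) / den M z)) =
   (mob_b N)^* * ((mob_a M)^* * z - mob_b M) by field.
by rewrite /den /= rmorphD !rmorphM /= conjCK; ring.
Qed.

(** The special form of the mean value equality for Moebius maps: on the circle,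
the ratio of distances is the geometric mean of the derivatives at the two
points. *)
Lemma mob_inv_dist M x z : circle x -> circle z ->
  normc (mob_inv M x - mob_inv M z) =
  normc (x - z) / (normc (den M x) * normc (den M z)).
Proof.
move=> x1 z1; have dx := den_neq0 M x1; have dz := den_neq0 M z1.
rewrite -normcM -normcV.
rewrite -normcM; congr normc; rewrite !mob_invE.
transitivity ((mob_a M * (mob_a M)^* - mob_b M * (mob_b M)^*) * (x - z) /
  (den M x * den M z)); last by rewrite mob_detC mul1r.
rewrite /den in dx dz *.
by field; rewrite dx dz.
Qed.

Lemma den_cvg M x : den M z @[z --> x] --> den M x.
Proof.
apply: (cvgB (FF := nbhs_filter x)); first exact: cvg_cst.
by apply: (cvgMr (FF := nbhs_filter x)); exact: cvg_id.
Qed.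

Lemma mob_inv_cvg M x : circle x -> mob_inv M z @[z --> x] --> mob_inv M x.
Proof.
move=> x1; rewrite mob_invE.
rewrite (_ : (fun z => mob_inv M z) =
  (fun z => ((mob_a M)^* * z - mob_b M) * (den M z)^-1)); last first.
  by apply/funext => z; rewrite mob_invE.
apply: (cvgM (FF := nbhs_filter x)).
  apply: (cvgB (FF := nbhs_filter x)); last exact: cvg_cst.
  by apply: (cvgMr (FF := nbhs_filter x)); exact: cvg_id.
exact: (cvgV (FF := nbhs_filter x) (den_neq0 M x1) (den_cvg (M := M) (x := x))).
Qed.

Lemma mob_cvg M x : circle x -> M z @[z --> x] --> M x.
Proof.
move=> x1; rewrite -(mob_invK_fun M x).
by rewrite -(funext (mob_invK_fun M)); exact: mob_inv_cvg.
Qed.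

(** The difference quotient is (d_M(x) d_M(x + h))^-1 exactly, because the
determinant of M is 1. *)
Lemma bullet_mob_inv M x : circle x ->
  bullet (mob_inv M) x = (normc (den M x) ^+ 2)^-1.
Proof.
move=> x1; have dx := den_neq0 M x1.
rewrite /bullet.
suff -> : derive1 (mob_inv M) x = (den M x ^+ 2)^-1.
  by rewrite normcV expr2 normcM.
apply: cvg_lim => //.
have dh : den M (h + x) @[h --> (0 : R[i])] --> den M x.
  apply: (cvg_comp (fun h : R[i] => h + x) (den M) _ (den_cvg (x := x))).
  have -> : nbhs x = nbhs (0 + x) by rewrite add0r.
  by apply: (cvgD (FF := nbhs_filter 0)); [exact: cvg_id | exact: cvg_cst].
have : (den M x)^-1 * (den M (h + x))^-1 @[h --> (0 : R[i])] -->
       (den M x ^+ 2)^-1.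
  rewrite expr2 invfM; apply: (cvgMr (FF := nbhs_filter 0)).
  exact: (cvgV (FF := nbhs_filter 0) dx dh).
move=> dh'; apply: cvg_trans (cvg_trans (cvg_app _ (@nbhs_dnbhs _ 0)) dh').
apply: near_eq_cvg.
have : \forall h \near (0 : R[i]), den M (h + x) != 0.
  have /(cvgCP (FF := nbhs_filter 0)) /(_ _ (den_gt0 M x1)) := dh.
  apply: (filterS (Filter := nbhs_filter 0)) => h.
  by apply: contraTneq => ->; rewrite subr0 ltxx.
move/(@nbhs_dnbhs _ 0) => dn0.
have : \forall h \near (0 : R[i])^', den M (h + x) != 0 /\ h != 0.
  by apply: filterI => //; exact: nbhs_dnbhs_neq.
apply: filterS => h [hd h0] /=; rewrite !mob_invE /GRing.scale /=.
transitivity ((mob_a M * (mob_a M)^* - mob_b M * (mob_b M)^*) *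
  (den M x * den M (h + x))^-1); first by rewrite mob_detC mul1r invfM.
rewrite /den in dx hd *.
by field; rewrite h0 dx hd.
Qed.

End MobiusGeometry.

(** * Mass left away from a point *)

Section UniformMass.
Context {R : realType}.
Implicit Types (x y z : R[i]) (M : mobius R).

Lemma normc_leD (a b : R) : normc (a +i* b)%C <= `|a| + `|b|.
Proof.
rewrite /= -(@ger0_norm _ (`|a| + `|b|)) ?addr_ge0 // -sqrtr_sqr.
rewrite ler_sqrt ?sqr_ge0 //.
rewrite sqrrD !real_normK ?num_real // lerD2r lerDl.
by rewrite mulrn_wge0 // mulr_ge0.
Qed.

Lemma circle_expi (t : R) : circle (expi t).
Proof. by rewrite /circle /= normE /= cos2Dsin2 sqrtr1. Qed.

Lemma expi_cvg (s : R) : expi t @[t --> s] --> expi s.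
Proof.
apply/(cvgCP (FF := nbhs_filter s)) => e e0.
have e2 : 0 < e / 2 by rewrite divr_gt0.
near=> t.
have -> : expi s - expi t = ((cos s - cos t) +i* (sin s - sin t))%C by [].
apply: le_lt_trans (normc_leD _ _) _; rewrite [ltRHS]splitr ltrD //.
  by near: t; have /cvgrPdist_lt := @continuous_cos R s; apply.
by near: t; have /cvgrPdist_lt := @continuous_sin R s; apply.
Unshelve. all: by end_near.
Qed.

Lemma circle_expi_ex z : circle z ->
  exists2 t : R, (t \in `[- pi, pi]%R) & z = expi t.
Proof.
move=> z1; have := normc_circle z1; case: z z1 => a b _ /= ab.
have {}ab : a ^+ 2 + b ^+ 2 = 1.
  by rewrite -(@sqr_sqrtr _ (a ^+ 2 + b ^+ 2)) ?ab ?expr1n // addr_ge0 ?sqr_ge0.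
have a2 : a ^+ 2 <= 1 by have := sqr_ge0 b; lra.
have a1 : -1 <= a <= 1 by rewrite -ler_norml -sqrtr_sqr -sqrtr1 ler_sqrt.
have ca : cos (acos a) = a by rewrite acosK.
have sa : sin (acos a) = `|b|.
  by rewrite sin_acos // -sqrtr_sqr; congr Num.sqrt; lra.
have a0 := acos_ge0 a1; have api := acos_lepi a1.
case: (leP 0 b) => b0.
  exists (acos a); first by rewrite in_itv /= api andbT; lra.
  by rewrite /expi ca sa ger0_norm.
exists (- acos a); first by rewrite in_itv /=; apply/andP; split; lra.
by rewrite /expi cosN sinN ca sa ltr0_norm // opprK.
Qed.

Lemma measurable_fun_cvgC (h : R -> R[i]) :
  (forall s, h t @[t --> s] --> h s) -> measurable_fun setT h.
Proof.
move=> ch; apply: (measurability (@open R[i])) => //.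
move=> _ [U oU <-]; rewrite setTI; apply: open_measurable.
by apply: open_comp => // s _; exact: ch.
Qed.

Lemma measurable_fun_cont (f : R[i] -> R) (D : set R[i]) :
  continuous f -> measurable_fun D f.
Proof.
move=> cf; apply: measurable_funTS.
apply: (measurability _ (RGenOInfty.measurableE R)) => _ [_ [a ->] <-].
rewrite setTI; apply: sub_sigma_algebra; apply: open_comp => //.
Qed.

Lemma measurable_circle : measurable (@circle R).
Proof.
have mf := measurable_fun_cont (D := setT) (@continuous_dist R 0).
have := mf measurableT [set 1] (measurable_set1 1).
rewrite setTI; congr (measurable _); apply/seteqP; split=> z /=; rewrite subr0.
  by move=> z1; rewrite /circle /= normE z1.
exact: normc_circle.
Qed.

Lemma mob_expi_cvg M (s : R) : M (expi t) @[t --> s] --> M (expi s).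
Proof.
exact: (cvg_comp (@expi R) (mob_fun M) (@expi_cvg s) (mob_cvg (circle_expi s))).
Qed.

Lemma opposite_quarters (s t : R) :
  s \in `[0, pi / 2]%R -> t \in `[pi, pi + pi / 2]%R ->
  1 <= normc (expi s - expi t).
Proof.
rewrite !in_itv /= => /andP[s0 s1] /andP[t0 t1].
have p0 := pi_gt0 R.
have cs : 0 <= cos s by apply: cos_ge0_pihalf; apply/andP; split; lra.
have ss : 0 <= sin s by apply: sin_ge0_pi; apply/andP; split; lra.
set r := t - pi.
have tr : t = r + pi by rewrite /r subrK.
have ct : 0 <= cos r by apply: cos_ge0_pihalf; rewrite /r; apply/andP; split; lra.
have st : 0 <= sin r by apply: sin_ge0_pi; rewrite /r; apply/andP; split; lra.
rewrite tr cosDpi sinDpi !opprK -[leLHS]sqrtr1.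
rewrite ler_sqrt; last by rewrite addr_ge0 ?sqr_ge0.
have := cos2Dsin2 s; have := mulr_ge0 cs ct; have := mulr_ge0 ss st.
have := sqr_ge0 (cos r); have := sqr_ge0 (sin r).
rewrite !sqrrD !mulr2n; lra.
Qed.

Lemma uniform_quarter (a : R) : 0 <= a -> a + pi / 2 <= pi *+ 2 ->
  uniform_prob (@pi2_gt0 R) `[a, a + pi / 2] = (4^-1)%:E.
Proof.
move=> a0 a1; have p0 := pi_gt0 R; rewrite /uniform_prob.
rewrite (eq_integral (fun=> ((pi *+ 2)^-1)%:E)); last first.
  move=> x; rewrite inE /= in_itv /= => /andP[x0 x1].
  by rewrite /uniform_pdf subr0 (le_trans a0 x0) (le_trans x1 a1).
rewrite integral_cst //= lebesgue_measure_itv /= lte_fin ltrDl divr_gt0 //.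
rewrite -EFinD -EFinM; congr EFin; rewrite -mulr_natr.
move: p0; rewrite lt0r => /andP[]; move: (pi : R) => p p0 _.
by rewrite mulr2n; field; rewrite -mulr2n mulrn_eq0 negb_or p0.
Qed.

(** A set of diameter less than 1 in the circle misses one of two opposite
quarters, so at least a quarter of the mass is sent at distance d or more
from x. *)
Lemma mass_away M x (d : R) : 0 < d ->
  (forall y z, circle y -> circle z ->
     normc (M y - x) < d -> normc (M z - x) < d -> normc (y - z) < 1) ->
  ((d / 4)%:E <=
   \int[pushforward uniform_circle M]_(z in circle) (normc (z - x))%:E)%E.
Proof.
move=> d0 small; have p0 := pi_gt0 R.
have [a [a0 a1 far]] : exists a : R, [/\ 0 <= a, a + pi / 2 <= pi *+ 2 &
    forall t, t \in `[a, a + pi / 2]%R -> d <= normc (M (expi t) - x)].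
  case: (pselect (forall t, t \in `[0 : R, pi / 2]%R ->
                            d <= normc (M (expi t) - x))) => [h|].
    exists 0; rewrite add0r; split => //; move: (pi : R) p0 => p p0.
    by rewrite -mulr_natr; lra.
  move=> /existsNP [s /not_implyP [sI /negP]]; rewrite -ltNge => sd.
  exists pi; split; first exact: ltW.
    by move: (pi : R) p0 => p p0; rewrite -mulr_natr; lra.
  move=> t tI; rewrite leNgt; apply/negP => td.
  have := small _ _ (circle_expi s) (circle_expi t) sd td.
  by rewrite ltNge opposite_quarters.
pose h : measurableTypeR R -> R[i] := fun t => M (expi t).
have mh : measurable_fun setT h.
  by apply: measurable_fun_cvgC => s; exact: mob_expi_cvg.
have -> : pushforward uniform_circle M =
          pushforward (uniform_prob (@pi2_gt0 R)) h.
  by [].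
have mf D := measurable_fun_cont (D := D) (@continuous_dist R x).
rewrite (@ge0_integral_pushforward _ _ _ _ R h mh (uniform_prob (@pi2_gt0 R))
  circle (fun z => (normc (z - x))%:E)); first last.
- by move=> z _; rewrite lee_fin normc_ge0.
- by apply/measurable_EFinP; exact: mf.
- exact: measurable_circle.
have -> : h @^-1` circle = setT.
  by apply/seteqP; split => // t _; apply: circle_mob; exact: circle_expi.
pose E : set (measurableTypeR R) := `[a, a + pi / 2]%classic.
have mE : measurable E by exact: measurable_itv.
have mfh : measurable_fun setT (fun t => (normc (h t - x))%:E).
  by apply/measurable_EFinP; exact: (measurableT_comp (mf setT) mh).
apply: (@le_trans _ _ (\int[uniform_prob (@pi2_gt0 R)]_(t in E)
   d%:E))%E.
  rewrite integral_cst //= uniform_quarter //.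
apply: (@le_trans _ _ (\int[uniform_prob (@pi2_gt0 R)]_(t in E)
   (normc (h t - x))%:E))%E.
  apply: ge0_le_integral => //.
  - by move=> t _; rewrite lee_fin ltW.
  - exact: measurable_funTS.
by apply: ge0_subset_integral => // t _; rewrite lee_fin normc_ge0.
Qed.

(** Weak convergence tested on the distance to x. *)
Lemma represents_dist0 (G : nat -> mobius R) x : represents G x ->
  (\int[pushforward uniform_circle (G n)]_(z in circle) (normc (z - x))%:E)%E
    @[n --> \oo] --> 0%E.
Proof.
move=> [x1] /(_ (fun z => normc (z - x))).
have -> : (\int[\d_x]_(z in circle) (normc (z - x))%:E)%E = 0%E.
  rewrite integral_dirac //=.
  - by rewrite subrr normc0 mule0.
  - exact: measurable_circle.
  - by apply/measurable_EFinP; exact: measurable_fun_cont (@continuous_dist R x).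
by apply; apply: continuous_subspaceT; exact: continuous_dist.
Qed.

End UniformMass.

(** * Contracting sequences represent no point *)

Section MobiusMonoid.
Context {R : realType}.
Implicit Types (M N P : mobius R) (x y z : R[i]).

(** Equality of coefficients, not only of maps, so that words can be
reassociated by rewriting. *)
Lemma mobius_eq M N : mob_a M = mob_a N -> mob_b M = mob_b N -> M = N.
Proof.
case: M N => a b ab [a' b' ab'] /= ea eb; move: ab'; rewrite -ea -eb => ab'.
by congr Mobius; exact: eq_irrelevance.
Qed.

Lemma mob_compA M N P : mob_comp M (mob_comp N P) = mob_comp (mob_comp M N) P.
Proof.
by apply: mobius_eq => /=; rewrite !rmorphD !rmorphM /= !conjCK; ring.
Qed.

Lemma mob_comp1m M : mob_comp mob_id M = M.
Proof. by apply: mobius_eq => /=; rewrite mul1r mul0r addr0. Qed.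

Lemma mob_compm1 M : mob_comp M mob_id = M.
Proof.
by apply: mobius_eq => /=; rewrite ?rmorph0 ?rmorph1 !mulr0 ?mulr1 ?addr0 ?add0r.
Qed.

End MobiusMonoid.

(** G is a sequence of partial compositions of the maps s k, and the derivatives
of the inverses of the G k at x are at most r ^ k. The number d k has modulus
the power -1/2 of the height of G_k(0) in the half-plane with x at infinity. As
the distance of G_k(0) to x is |d k| / |a_k|, a bound on |c k| = |b_k| / |d k|
keeps G_k(0) away from x. *)
Section Horocycle.
Context {R : realType}.
Variables (G s : nat -> mobius R) (x : R[i]) (r K : R).
Hypotheses (x1 : circle x) (r01 : 0 < r < 1)
  (GS : forall k, G k.+1 = mob_comp (G k) (s k))
  (sK : forall k, normc (mob_b (s k)) <= K)
  (Gr : forall k, (r ^+ k)^-1 <= normc (den (G k) x) ^+ 2).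

Let d k := den (G k) x.
Let c k := (mob_b (G k))^* / d k.

Let r0 : 0 < r. Proof. by case/andP: r01. Qed.
Let d0 k : 0 < normc (d k). Proof. exact: den_gt0. Qed.

Lemma den_ge1 k : 1 <= normc (d k) ^+ 2.
Proof.
apply: le_trans (Gr k); rewrite invf_ge1 ?exprn_gt0 //.
by apply: exprn_ile1; rewrite ltW //; case/andP: r01.
Qed.

(** The difference is exactly conj(b) / (d k * d k.+1), with b the second
coefficient of s k, and the product of the denominators is at least r ^ -k. *)
Lemma horocycle_step k : normc (c k.+1 - c k) <= K * r ^+ k.
Proof.
have dk : d k != 0 by exact: den_neq0.
have dk1 : d k.+1 != 0 by exact: den_neq0.
have -> : c k.+1 - c k = (mob_b (s k))^* / (d k * d k.+1).
  have dS : d k.+1 = mob_a (s k) * d k +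
                     (mob_b (s k))^* * (mob_b (G k) - (mob_a (G k))^* * x).
    by rewrite /d GS /den /= rmorphD !rmorphM /= conjCK; ring.
  have bS : (mob_b (G k.+1))^* =
      (mob_a (G k))^* * (mob_b (s k))^* + (mob_b (G k))^* * mob_a (s k).
    by rewrite GS /= rmorphD !rmorphM /= conjCK.
  (* The determinant of G k appears in the numerator. *)
  have num : (mob_b (G k.+1))^* * d k - (mob_b (G k))^* * d k.+1 = (mob_b (s k))^*.
    rewrite dS bS -[RHS]mulr1 -(mob_detC (G k)) /d /den; ring.
  rewrite -[X in _ = X / _]num /c.
  by field; rewrite dk dk1.
rewrite normcM normc_conj normcV.
rewrite ler_pM ?normc_ge0 ?invr_ge0 ?normc_ge0 //.
rewrite normcM -[leRHS]invrK lef_pV2 ?posrE; first last.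
- by rewrite invr_gt0 exprn_gt0.
- by rewrite mulr_gt0.
rewrite -(ler_pXn2r (n := 2)) ?nnegrE //; first last.
- by rewrite mulr_ge0 ?normc_ge0.
- by rewrite invr_ge0 exprn_ge0 // ltW.
rewrite exprMn expr2 ler_pM ?invr_ge0 ?exprn_ge0 ?(ltW r0) ?Gr //.
apply: le_trans (Gr k.+1).
rewrite lef_pV2 ?posrE ?exprn_gt0 // exprS ler_piMl ?exprn_ge0 ?(ltW r0) //.
by rewrite ltW //; case/andP: r01.
Qed.

(** Geometric summation of the steps. *)
Lemma horocycle_bound k :
  normc (mob_b (G k)) <=
  (normc (c 0) + K / (1 - r)) * normc (d k).
Proof.
have K0 : 0 <= K by apply: le_trans (sK 0); exact: normc_ge0.
have r1 : 0 < 1 - r by rewrite subr_gt0; case/andP: r01.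
have -> : normc (mob_b (G k)) = normc (c k) * normc (d k).
  rewrite -normcM /c divfK ?normc_conj //.
  exact: den_neq0.
rewrite ler_pM2r //.
suff h : normc (c k) <= normc (c 0) + K * (1 - r ^+ k) / (1 - r).
  apply: le_trans h _; rewrite lerD2l ler_pM2r ?invr_gt0 // ler_piMr //.
  by rewrite gerBl exprn_ge0 // ltW.
elim: k => [|k IH]; first by rewrite expr0 subrr mulr0 mul0r addr0.
apply: le_trans (normc_le_dist _ (c k)) _; rewrite normc_distC.
apply: le_trans (lerD IH (horocycle_step k)) _.
rewrite le_eqVlt; apply/orP; left; apply/eqP; rewrite exprS; field.
by rewrite gt_eqF.
Qed.

(** The bound on b_k / d_k makes d_k(z) comparable to d_k(x) for all k and all z
in one neighbourhood of x, so the inverse of G k shrinks this neighbourhood to a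
set of small diameter, and [mass_away] applies uniformly in k. *)
Lemma contracting_not_represents : ~ represents G x.
Proof.
move=> Gx.
have K0 : 0 <= K by apply: le_trans (sK 0); exact: normc_ge0.
have r1 : 0 < 1 - r by rewrite subr_gt0; case/andP: r01.
set C := normc (c 0) + K / (1 - r).
have C0 : 0 <= C by rewrite addr_ge0 ?normc_ge0 // divr_ge0 // ltW.
(* Small enough for C * e <= 1/2, which gives |d_k(z)| >= |d_k(x)| / 2, and
   for 4 * e <= 1, the diameter wanted by [mass_away]. *)
pose e := (2 * C + 4)^-1.
have C4 : 0 < 2 * C + 4 by lra.
have e0 : 0 < e by rewrite invr_gt0.
have e4 : 4 * e <= 1.
  by rewrite /e ler_pdivrMr // mul1r; lra.
have Ce : C * e <= 2^-1.
  by rewrite /e ler_pdivrMr //; lra.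
have half k z : normc (z - x) < e -> normc (d k) / 2 <= normc (den (G k) z).
  move=> zx; have := normc_le_dist (d k) (den (G k) z).
  have -> : den (G k) z - d k = - ((mob_b (G k))^* * (z - x)).
    by rewrite /d /den; ring.
  rewrite normcN normcM normc_conj => h.
  have : normc (mob_b (G k)) * normc (z - x) <= C * normc (d k) * e.
    by rewrite ler_pM ?normc_ge0 ?horocycle_bound // ltW.
  have : C * e * normc (d k) <= 2^-1 * normc (d k) by rewrite ler_pM2r.
  rewrite [C * e * _]mulrAC; lra.
have close k y : circle y -> normc (G k y - x) < e ->
    normc (y - mob_inv (G k) x) < 2 * e.
  move=> y1 yx; rewrite -{1}(mobK (G k) y1) mob_inv_dist //; last exact: circle_mob.
  rewrite ltr_pdivrMr ?mulr_gt0 ?den_gt0 //; last exact: circle_mob.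
  have hf := half k _ yx.
  apply: lt_le_trans yx _; rewrite -mulrA mulrCA -[leLHS]mulr1 ler_pM2l //.
  apply: le_trans (den_ge1 k) _; rewrite expr2 mulrA ler_pM2r //.
  rewrite -/(d k); lra.
have away k := @mass_away _ (G k) x e e0.
have lb k : ((e / 4)%:E <= \int[pushforward uniform_circle (G k)]_(z in circle)
    (normc (z - x))%:E)%E.
  apply: away => y z y1 z1 yx zx.
  have -> : y - z = (y - mob_inv (G k) x) - (z - mob_inv (G k) x) by ring.
  have := normc_le_dist (y - mob_inv (G k) x - (z - mob_inv (G k) x))
             (y - mob_inv (G k) x).
  have -> : y - mob_inv (G k) x -
     (y - mob_inv (G k) x - (z - mob_inv (G k) x)) = z - mob_inv (G k) x by ring.
  have := close k y y1 yx; have := close k z z1 zx; lra.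
have lim0 := represents_dist0 Gx.
have : ((e / 4)%:E <= 0 :> \bar R)%E.
  rewrite -(cvg_lim _ lim0) //; apply: lime_ge; first by apply/cvg_ex; exists 0%E.
  by apply: nearW.
by rewrite lee_fin leNgt divr_gt0.
Qed.

End Horocycle.

(** * Refined sets and expansion along words *)

Section WordMaps.
Context {R : realType} {A : finType}.
Variables (F : A -> mobius R) (W : A -> set R[i]).
Hypothesis WC : forall a, W a `<=` circle.
Implicit Types (u v : seq A) (x z : R[i]).

Lemma mob_word_cat u v :
  mob_word F (u ++ v) = mob_comp (mob_word F u) (mob_word F v).
Proof.
elim: u => [|a u IH]; first by rewrite mob_comp1m.
by rewrite /= -/(mob_word F (u ++ v)) IH mob_compA.
Qed.

Lemma mob_word1 a : mob_word F [:: a] = F a.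
Proof. exact: mob_compm1. Qed.

Lemma refinedP u z : refined F W u z <->
  circle z /\ forall a0 i, (i < size u)%N ->
    (mob_word F (take i u) @` W (nth a0 u i)) z.
Proof.
split=> -[z1 h]; split=> //.
  move=> a0 i iu; have := h (Ordinal iu) I.
  by rewrite (tnth_nth a0).
move=> i _; have a0 : A := tnth (in_tuple u) i.
by rewrite (tnth_nth a0); exact: h (ltn_ord i).
Qed.

Lemma refined_catl u v : refined F W (u ++ v) `<=` refined F W u.
Proof.
move=> z /refinedP [z1 h]; apply/refinedP; split=> // a0 i iu.
have := h a0 i; rewrite size_cat ltn_addr // nth_cat iu takel_cat ?(ltnW iu) //.
exact.
Qed.

(** With [refined_catl], half of the identity between the refined set of u ++ v
and the intersection of that of u with the image of that of v; only these
inclusions pass to closures. *)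
Lemma refined_catr u v z : refined F W (u ++ v) z ->
  refined F W v (mob_inv (mob_word F u) z).
Proof.
move=> /refinedP [z1 h]; apply/refinedP; split; first exact: circle_mob_inv.
move=> a0 i iv; have := h a0 (size u + i)%N.
rewrite size_cat ltn_add2l => /(_ iv) [y].
rewrite nth_cat ltnNge leq_addr /= addKn take_cat ltnNge leq_addr /= addKn.
move=> Wy; have y1 := WC Wy; rewrite mob_word_cat mob_compE // => <-.
by exists y => //; rewrite mobK //; exact: circle_mob.
Qed.

Lemma closed_circle : closed (@circle R).
Proof.
have -> : @circle R = (fun z => normc (z - 0)) @^-1` [set 1].
  apply/seteqP; split=> z /=; rewrite subr0; first exact: normc_circle.
  by move=> z1; rewrite /circle /= normE z1.
apply: closed_comp; last exact: closed_eq.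
by move=> z _; exact: continuous_dist.
Qed.

Lemma closure_refined_circle u : closure (refined F W u) `<=` circle.
Proof.
rewrite [X in _ `<=` X](closure_id _).1; last exact: closed_circle.
by apply: closure_subset => z [].
Qed.

Lemma closure_refined_catl u v :
  closure (refined F W (u ++ v)) `<=` closure (refined F W u).
Proof. exact: closure_subset (@refined_catl u v). Qed.

Lemma closure_refined_catr u v x : closure (refined F W (u ++ v)) x ->
  closure (refined F W v) (mob_inv (mob_word F u) x).
Proof.
move=> clx; have x1 := closure_refined_circle clx.
exact: (closure_image_sub (mob_inv_cvg x1) (@refined_catr u v) clx).
Qed.

Definition expansion u x : R := bullet (mob_inv (mob_word F u)) x.

Lemma expansionE u x : circle x ->
  expansion u x = (normc (den (mob_word F u) x) ^+ 2)^-1.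
Proof. exact: bullet_mob_inv. Qed.

Lemma expansion_gt0 u x : circle x -> 0 < expansion u x.
Proof. by move=> x1; rewrite expansionE // invr_gt0 exprn_gt0 // den_gt0. Qed.

(** Chain rule. *)
Lemma expansion_cat u v x : circle x ->
  expansion (u ++ v) x = expansion u x * expansion v (mob_inv (mob_word F u) x).
Proof.
move=> x1; rewrite !expansionE //; last exact: circle_mob_inv.
by rewrite mob_word_cat den_comp // normcM exprMn invfM.
Qed.

(** A common bound for the derivatives of the letters and of their inverses, and
for their second coefficients. *)
Definition system_bound : R :=
  1 + \sum_a (normc (mob_a (F a)) + normc (mob_b (F a))) ^+ 2.

Lemma system_bound_ge1 : 1 <= system_bound.
Proof. by rewrite lerDl sumr_ge0 // => a _; exact: sqr_ge0. Qed.

Lemma system_bound_letter a :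
  (normc (mob_a (F a)) + normc (mob_b (F a))) ^+ 2 <= system_bound.
Proof.
rewrite /system_bound (bigD1 a) //= addrCA lerDl addr_ge0 // sumr_ge0 // => b _.
exact: sqr_ge0.
Qed.

Lemma mob_normc_det (M : mobius R) :
  (normc (mob_a M) - normc (mob_b M)) * (normc (mob_a M) + normc (mob_b M)) = 1.
Proof.
rewrite -subr_sqr; apply: complexI.
by rewrite rmorphB !rmorphXn /= -!normE mob_det.
Qed.

Lemma mob_normc_ge1 (M : mobius R) : 1 <= normc (mob_a M) + normc (mob_b M).
Proof.
have := mob_normc_det M; have := mob_bC_lt_a M; have := normc_ge0 (mob_b M).
move: (normc (mob_a M)) (normc (mob_b M)) => a b b0 ab e.
rewrite leNgt; apply/negP => h; nra.
Qed.

Lemma system_bound_b a : normc (mob_b (F a)) <= system_bound.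
Proof.
apply: le_trans (system_bound_letter a).
have := mob_normc_ge1 (F a); have := normc_ge0 (mob_a (F a)).
have := normc_ge0 (mob_b (F a)).
move: (normc (mob_a _)) (normc (mob_b _)) => p q p0 q0 pq; nra.
Qed.

(** Since (|a| - |b|) (|a| + |b|) = 1, the modulus of the denominator lies
between (|a| + |b|)^-1 and |a| + |b|. *)
Lemma expansion_letter a x : circle x ->
  system_bound^-1 <= expansion [:: a] x <= system_bound.
Proof.
move=> x1; rewrite expansionE // mob_word1.
have K1 := system_bound_ge1; have Ka := system_bound_letter a.
have dx := den_gt0 (F a) x1.
have bx : normc ((mob_b (F a))^* * x) = normc (mob_b (F a)).
  by rewrite normcM (normc_circle x1) mulr1 normc_conj.
have up : normc (den (F a) x) <= normc (mob_a (F a)) + normc (mob_b (F a)).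
  have := normc_le_dist (den (F a) x) (mob_a (F a)).
  have -> : mob_a (F a) - den (F a) x = (mob_b (F a))^* * x by rewrite /den; ring.
  by rewrite bx.
have lo : normc (mob_a (F a)) - normc (mob_b (F a)) <= normc (den (F a) x).
  have := normc_le_dist (mob_a (F a)) ((mob_b (F a))^* * x).
  by rewrite normc_distC -/(den (F a) x) bx; lra.
have e := mob_normc_det (F a); have s1 := mob_normc_ge1 (F a).
move: (normc (den _ _)) (normc (mob_a _)) (normc (mob_b _)) dx up lo Ka e s1.
move=> d p q d0 up lo Ka e s1; apply/andP; split.
  rewrite lef_pV2 ?posrE ?exprn_gt0 //; last by lra.
  by apply: le_trans Ka; rewrite ler_pXn2r ?nnegrE //; lra.
apply: le_trans Ka; rewrite -[leRHS]invrK lef_pV2 ?posrE ?exprn_gt0 //; last first.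
  by rewrite invr_gt0 exprn_gt0 //; lra.
rewrite -exprVn ler_pXn2r ?nnegrE ?invr_ge0 //; try lra.
suff -> : (p + q)^-1 = p - q by [].
by rewrite -[RHS]mulr1 -(@mulfV _ (p + q)) ?mulrA ?e ?mul1r // gt_eqF //; lra.
Qed.

Lemma expansion_bound u x : circle x ->
  (system_bound ^+ size u)^-1 <= expansion u x <= system_bound ^+ size u.
Proof.
have K1 := system_bound_ge1.
have K0 : 0 < system_bound by lra.
elim: u x => [|a u IH] x x1.
  rewrite expr0 invr1 expansionE // /den /= rmorph0 mul0r subr0.
  by rewrite normc1 expr1n invr1 lexx.
rewrite -cat1s expansion_cat // mob_word1 /= exprS invfM.
have /andP[l1 l2] := expansion_letter a x1.
have y1 := circle_mob_inv (F a) x1; have /andP[h1 h2] := IH _ y1.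
have K0' := ltW K0; have e0 := ltW (expansion_gt0 [:: a] x1).
have e1 := ltW (expansion_gt0 u y1).
move: (expansion _ _) (expansion _ _) l1 l2 h1 h2 e0 e1.
move=> p q l1 l2 h1 h2 p0 q0; apply/andP; split.
  by rewrite ler_pM // invr_ge0 ?exprn_ge0.
by rewrite ler_pM.
Qed.

End WordMaps.

(** * Compactness *)

Lemma prefix_wordS (A : finType) (w : A^ω) n :
  prefix_word w n.+1 = rcons (prefix_word w n) (w n).
Proof. exact: mkseqS. Qed.

Lemma prefix_word_split (A : finType) (w : A^ω) k n : (k <= n)%N ->
  exists v, prefix_word w n = prefix_word w k ++ v.
Proof.
move=> kn; exists (drop k (prefix_word w n)).
rewrite -{1}(cat_take_drop k (prefix_word w n)); congr cat.
by rewrite /prefix_word /mkseq -map_take take_iota (minn_idPl kn).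
Qed.

Lemma nbhs_prefix (A : finType) (w : A^ω) k :
  nbhs w [set w' : A^ω | prefix_word w' k = prefix_word w k].
Proof.
elim: k => [|k IH]; first exact: filterS filterT.
have : nbhs w [set w' : A^ω | w' k = w k].
  have := @proj_continuous nat (fun=> (discrete_topology A : topologicalType)) k w.
  have : nbhs (proj k w : discrete_topology A) [set w k : discrete_topology A].
    by rewrite nbhs_principalE => y ->.
  by move=> /[swap] /[apply].
move=> h; apply: (filterS (Filter := nbhs_filter w)) (filterI IH h) => w' [h1 h2].
by rewrite /= !prefix_wordS h1 h2.
Qed.

Lemma compact_words (A : finType) (S : set A^ω) : closed S -> compact S.
Proof.
move=> clS; apply: (subclosed_compact clS) (@subsetT _ _).
have := @tychonoff nat (fun=> (discrete_topology A : topologicalType))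
  (fun=> setT) (fun=> @finite_compact (discrete_topology A) setT finite_finset).
by congr compact; apply/seteqP; split.
Qed.

Lemma compact_circle (R : realType) : compact (@circle R).
Proof.
have -> : @circle R = expi @` `[- pi, pi].
  apply/seteqP; split=> z; last by move=> [t _ <-]; exact: circle_expi.
  by move=> /circle_expi_ex [t tI ->]; exists t.
apply: continuous_compact; last exact: segment_compact.
by apply: continuous_subspaceT => t; exact: expi_cvg.
Qed.

Section Language.
Context {A : finType}.
Variable S : set A^ω.
Hypothesis subS : subshift S.

Lemma lang_prefix_ex u : lang S u ->
  exists2 w, S w & u = prefix_word w (size u).
Proof.
move=> [w [Sw [i ->]]]; rewrite size_mkseq; move: (size u) => n.
suff [w' Sw' e] : exists2 w', S w' & forall j, w' j = w (i + j)%N.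
  by exists w' => //; apply: eq_mkseq => j; rewrite e.
elim: i w Sw => [|i IH] w Sw; first by exists w.
by have [w' Sw' e] := IH _ (subS.2 _ Sw); exists w'.
Qed.

Lemma lang_prefix w n : S w -> lang S (prefix_word w n).
Proof. by move=> Sw; exists w; split=> //; exists 0%N; rewrite size_mkseq. Qed.

Lemma lang_catl u v : lang S (u ++ v) -> lang S u.
Proof.
move=> /lang_prefix_ex [w Sw]; rewrite size_cat => e.
have [v' e'] := prefix_word_split w (leq_addr (size v) (size u)).
suff -> : u = prefix_word w (size u) by exact: lang_prefix.
have := congr1 (take (size u)) e; rewrite e' !take_size_cat //.
by rewrite size_mkseq.
Qed.

Lemma lang_catr u v : lang S (u ++ v) -> lang S v.
Proof.
move=> /lang_prefix_ex [w Sw]; rewrite size_cat => e.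
exists w; split=> //; exists (size u).
have := congr1 (drop (size u)) e; rewrite drop_size_cat // => ->.
rewrite size_drop size_mkseq addKn /prefix_word /mkseq -map_drop drop_iota.
by rewrite addnC iotaDl addKn -map_comp.
Qed.

End Language.

(** * The growth rate is at least one *)

Section System.
Context {R : realType} {A : finType}.
Variables (F : A -> mobius R) (W : A -> set R[i]) (S : set A^ω).
Hypothesis WC : forall a, W a `<=` circle.
Let Sg := interval_shift F W S.
Hypotheses (subSg : subshift Sg) (Sg0 : Sg !=set0)
  (PhiSg : forall w, Sg w -> exists x, Phi_rel F w x)
  (capSg : forall w, Sg w ->
     \bigcap_(k in [set k | (0 < k)%N]) closure (refined F W (prefix_word w k))
     = [set Phi F w]).

Local Notation K := (system_bound F).
Local Notation cl u := (closure (refined F W u)).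

Let K0 : 0 < K. Proof. exact: lt_le_trans ltr01 (system_bound_ge1 F). Qed.

Lemma not_always_contracting r w x : 0 < r < 1 -> Sg w ->
  (forall k, cl (prefix_word w k) x) ->
  ~ (forall k, expansion F (prefix_word w k) x <= r ^+ k).
Proof.
move=> r01 Sw clx contr.
have x1 : circle x by exact: closure_refined_circle (clx 0%N).
have xPhi : x = Phi F w.
  have : [set Phi F w] x by rewrite -capSg // => k _; exact: clx.
  by [].
have rep : Phi_rel F w x.
  by have [y hy] := PhiSg Sw; rewrite xPhi; exact: (xgetPex 1 (ex_intro _ y hy)).
move: rep; apply: (@contracting_not_represents _ _ (fun k => F (w k)) x r K) => //.
- move=> k; rewrite prefix_wordS -cats1 mob_word_cat mob_word1 //.
- by move=> k; exact: system_bound_b.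
move=> k; have := contr k; rewrite expansionE // => h.
rewrite -[leRHS]invrK lef_pV2 // posrE ?invr_gt0 ?exprn_gt0 ?den_gt0 //.
by case/andP: r01.
Qed.

(** Otherwise pairs (w_L, x_L) that contract up to time L have a cluster point
(w, x) in the compact product of the interval shift and the circle. A prefix of
w is a prefix of some w_L with L large and x_L close to x, so w contracts at x
at all times. *)
Lemma expanding_time r : 0 < r < 1 -> exists L, forall w x, Sg w ->
  cl (prefix_word w L) x ->
  exists2 k, (0 < k <= L)%N & r ^+ k < expansion F (prefix_word w k) x.
Proof.
move=> r01; apply: contrapT => /forallNP noL.
have bad L : exists p : A^ω * R[i], [/\ Sg p.1, cl (prefix_word p.1 L) p.2 &
    forall k, (k <= L)%N -> expansion F (prefix_word p.1 k) p.2 <= r ^+ k].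
  apply: contrapT => /forallNP h; apply: (noL L) => w x Sw clx.
  apply: contrapT => /forall2NP h2; apply: (h (w, x)); split=> // k kL.
  have x1 := closure_refined_circle clx.
  case: (posnP k) => [->|k0].
    rewrite expr0; have /andP[] := expansion_bound F (prefix_word w 0) x1.
    by rewrite expr0.
  by have := h2 k; rewrite k0 kL /= => -[//|/negP]; rewrite -leNgt.
have [p hp] := choice bad.
have clp k L : (k <= L)%N -> cl (prefix_word (p L).1 k) (p L).2.
  move=> kL; have [_ + _] := hp L.
  have [v ->] := prefix_word_split (p L).1 kL; exact: closure_refined_catl.
have cpt := compact_setX (compact_words subSg.1) (@compact_circle R).
have [|[w x] [[/= Sw x1] clu]] := cpt (p @ \oo) _.
  exists 0%N => // L _; have [h1 h2 _] := hp L.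
  by split=> //; exact: closure_refined_circle h2.
have close k U : nbhs x U -> exists y, [/\ cl (prefix_word w k) y,
    expansion F (prefix_word w k) y <= r ^+ k & U y].
  move=> xU.
  have [] := clu [set q | exists2 L, (k <= L)%N & q = p L]
    [set q | prefix_word q.1 k = prefix_word w k /\ U q.2].
  - by exists k => // L /= kL; exists L.
  - exists ([set w' | prefix_word w' k = prefix_word w k], U) => /=; last by [].
    by split => //; exact: nbhs_prefix.
  move=> _ [[L kL ->] [wk xL]]; exists (p L).2.
  by have [_ _ h] := hp L; rewrite -wk; split=> //; [exact: clp | exact: h].
apply: (not_always_contracting (w := w) (x := x) r01 Sw) => k.
  by apply: closed_closure => U /(close k) [y [h _ Uy]]; exists y.
set u := prefix_word w k; rewrite leNgt; apply/negP.
rewrite expansionE // -[ltLHS]invrK ltf_pV2 ?posrE ?exprn_gt0 ?den_gt0 //; last first.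
  by rewrite invr_gt0 exprn_gt0 //; case/andP: r01.
set c := _^-1 => dc.
have c0 : 0 < c by rewrite invr_gt0 exprn_gt0 //; case/andP: r01.
have dsq : normc (den (mob_word F u) x) < Num.sqrt c.
  by rewrite -(ltr_pXn2r (n := 2)) ?nnegrE ?normc_ge0 ?sqrtr_ge0 // sqr_sqrtr // ltW.
have e0 : 0 < Num.sqrt c - normc (den (mob_word F u) x) by rewrite subr_gt0.
have /(cvgCP (FF := nbhs_filter x)) := den_cvg (M := mob_word F u) (x := x).
move=> /(_ _ e0) /(close k) [y [cly hy /= dxy]].
have y1 := closure_refined_circle cly.
have dy : normc (den (mob_word F u) y) < Num.sqrt c.
  have := normc_le_dist (den (mob_word F u) y) (den (mob_word F u) x); lra.
move: hy; rewrite leNgt => /negP; apply.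
rewrite expansionE // -[ltLHS]invrK ltf_pV2 ?posrE ?exprn_gt0 ?den_gt0 //.
rewrite -(@sqr_sqrtr _ (_^-1)) ?ltW //.
by rewrite ltr_pXn2r ?nnegrE ?normc_ge0 ?sqrtr_ge0.
Qed.

Lemma refined_lang u : lang Sg u -> cl u !=set0.
Proof.
move=> /(lang_prefix_ex subSg) [w [_ h] ->].
by have [z hz] := h (size u); exists z; exact: subset_closure.
Qed.

(** Cut off prefixes that expand more than r^length, as long as L letters
remain. The last piece has fewer than L letters and is bounded below by c. *)
Lemma uniform_expansion r : 0 < r < 1 -> exists2 c, 0 < c &
  forall u x, lang Sg u -> cl u x -> c * r ^+ size u <= expansion F u x.
Proof.
move=> r01; have [L hL] := expanding_time r01; have [r0 r1] := andP r01.
have K1 := system_bound_ge1 F.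
exists (K ^+ L)^-1; first by rewrite invr_gt0 exprn_gt0.
move=> u; have [n] := ubnP (size u); elim: n u => // n IH u un x lu clx.
have x1 := closure_refined_circle clx.
have [uL|Lu] := ltnP (size u) L.
  have /andP[h _] := expansion_bound F u x1; apply: le_trans h.
  apply: (@le_trans _ _ (K ^+ L)^-1).
    rewrite ler_piMr ?invr_ge0 ?exprn_ge0 ?(ltW K0) //.
    by rewrite exprn_ile1 // ltW.
  by rewrite lef_pV2 ?posrE ?exprn_gt0 // ler_weXn2l // ltnW.
have [w Sw uw] := lang_prefix_ex subSg lu.
have [v0 e0] := prefix_word_split w Lu.
have [k /andP[k0 kL] hk] : exists2 k, (0 < k <= L)%N &
    r ^+ k < expansion F (prefix_word w k) x.
  apply: hL => //; move: clx; rewrite uw e0; exact: closure_refined_catl.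
have [v e] := prefix_word_split w (leq_trans kL Lu).
have eu : u = prefix_word w k ++ v by rewrite -e.
have su : size u = (k + size v)%N by rewrite eu size_cat size_mkseq.
have lv : lang Sg v by apply: (lang_catr subSg (u := prefix_word w k)); rewrite -eu.
have clv : cl v (mob_inv (mob_word F (prefix_word w k)) x).
  by apply: closure_refined_catr => //; rewrite -eu.
have vn : (size v < n)%N.
  by move: un; rewrite su ltnS; apply: leq_trans; rewrite -[ltnLHS]add0n ltn_add2r.
have := IH v vn _ lv clv.
have y1 := circle_mob_inv (mob_word F (prefix_word w k)) x1.
have := expansion_gt0 F v y1.
rewrite eu expansion_cat // -eu su exprD.
move: (expansion _ _ _) (expansion _ _ _) hk => p q pk q0 qv.
rewrite mulrCA; apply: ler_pM => //; last exact: ltW.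
  by rewrite exprn_ge0 // ltW.
by rewrite mulr_ge0 ?invr_ge0 ?exprn_ge0 // ltW.
Qed.

Lemma Q_n_ge n (c : R) :
  (forall u x, lang Sg u -> size u = n -> cl u x -> c <= expansion F u x) ->
  c <= Q_n F W S n.
Proof.
move=> h; apply: lb_le_inf.
  have [w Sw] := Sg0; exists (q_word F W (prefix_word w n)).
  by exists (prefix_word w n) => //; split; [exact: lang_prefix|rewrite size_mkseq].
move=> _ [u [lu un] <-]; apply: lb_le_inf.
  by have [x clx] := refined_lang lu; exists (expansion F u x), x.
by move=> _ [x clx <-]; exact: h.
Qed.

Lemma q_word_le u x : cl u x -> q_word F W u <= expansion F u x.
Proof.
move=> clx; apply: ge_inf; last by exists x.
by exists 0 => _ [y _ <-]; exact: normc_ge0.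
Qed.

Lemma Q_n_le u x : lang Sg u -> cl u x -> Q_n F W S (size u) <= expansion F u x.
Proof.
move=> lu clx; apply: le_trans (q_word_le clx); apply: ge_inf; last by exists u.
exists 0 => _ [v [lv _] <-]; apply: lb_le_inf.
  by have [y cly] := refined_lang lv; exists (expansion F v y), y.
by move=> _ [y _ <-]; exact: normc_ge0.
Qed.

Lemma Q_n_bound n : K ^- n <= Q_n F W S n <= K ^+ n.
Proof.
apply/andP; split.
  apply: Q_n_ge => u x lu <- clx.
  by have /andP[] := expansion_bound F u (closure_refined_circle clx).
have [w Sw] := Sg0; have lw := lang_prefix n Sw.
have [x clx] := refined_lang lw.
have := Q_n_le lw clx; rewrite size_mkseq => h; apply: le_trans h _.
have /andP[_] := expansion_bound F (prefix_word w n) (closure_refined_circle clx).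
by rewrite size_mkseq.
Qed.

Lemma Q_n_ge0 n : 0 <= Q_n F W S n.
Proof.
have /andP[h _] := Q_n_bound n; apply: le_trans h.
by rewrite invr_ge0 exprn_ge0 // ltW.
Qed.

Lemma Q_n_supermul m n : Q_n F W S m * Q_n F W S n <= Q_n F W S (m + n).
Proof.
apply: Q_n_ge => u x lu un clx; have x1 := closure_refined_circle clx.
have e := cat_take_drop m u.
have sm : size (take m u) = m by rewrite size_takel // un leq_addr.
have sn : size (drop m u) = n by rewrite size_drop un addKn.
move: lu clx; rewrite -{}e => lu clx.
rewrite expansion_cat // -{1}sm -{1}sn ler_pM ?Q_n_ge0 //.
  by apply: Q_n_le; [exact: lang_catl lu | exact: closure_refined_catl clx].
by apply: Q_n_le; [exact: lang_catr lu | exact: closure_refined_catr clx].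
Qed.

(** For r1 < r2 in the interval between Q and 1, the values Q_n are eventually
at most r1^n, and at least c r2^n, which is impossible since (r1 / r2)^n tends
to 0. The convergence of the roots is needed to know that Q is their limit and
not a default value. *)
Lemma Q_ge1 : 1 <= Q F W S.
Proof.
rewrite leNgt; apply/negP => Q1.
have cvQ : cvgn (fun n => Q_n F W S n `^ n%:R^-1).
  exact: (supermultiplicative_root_cvg K0 Q_n_supermul Q_n_bound).
(* r1 and r2 cut the interval from max(0, Q) to 1 into thirds. *)
pose m := Num.max 0 (Q F W S).
have m0 : 0 <= m by rewrite le_max lexx.
have m1 : m < 1 by rewrite gt_max ltr01.
have mQ : Q F W S <= m by rewrite le_max lexx orbT.
pose r1 := (2 * m + 1) / 3; pose r2 := (m + 2) / 3.
have r10 : 0 < r1 by rewrite /r1; lra.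
have r12 : r1 < r2 by rewrite /r1 /r2; lra.
have r21 : r2 < 1 by rewrite /r2; lra.
have r20 : 0 < r2 by lra.
have Qr : Q F W S < r1 by rewrite /r1; lra.
have [c c0 hc] := @uniform_expansion r2 (introT andP (conj r20 r21)).
have small : \forall n \near \oo, c <= (r1 / r2) ^+ n.
  have /cvgrPdist_lt := cvQ.
  have e0 : 0 < r1 - Q F W S by rewrite subr_gt0.
  move=> /(_ _ e0); rewrite -/(Q F W S) => near1.
  near=> n.
  have n0 : (0 < n)%N by near: n; exists 1%N.
  have lt1 : Q_n F W S n `^ n%:R^-1 < r1.
    have : `|Q F W S - Q_n F W S n `^ n%:R^-1| < r1 - Q F W S by near: n.
    by rewrite ltr_norml => /andP[h1 h2]; lra.
  have lt2 : Q_n F W S n <= r1 ^+ n.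
    have -> : Q_n F W S n = (Q_n F W S n `^ n%:R^-1) ^+ n.
      rewrite -powR_mulrn ?powR_ge0 // -powRrM mulVf ?pnatr_eq0 -?lt0n //.
      by rewrite powRr1 // Q_n_ge0.
    by rewrite lerXn2r ?nnegrE ?powR_ge0 // ltW.
  have ge2 : c * r2 ^+ n <= Q_n F W S n.
    by apply: Q_n_ge => u x lu <- clx; exact: hc.
  by rewrite expr_div_n ler_pdivlMr ?exprn_gt0 //; exact: le_trans lt2.
have q1 : `|r1 / r2| < 1.
  rewrite (ger0_norm (divr_ge0 (ltW r10) (ltW r20))).
  by rewrite ltr_pdivrMr // mul1r.
have /cvgrPdist_lt /(_ _ c0) small' := cvg_expr q1.
have [n] := filter_ex (filterI small small').
rewrite /= => -[h1]; rewrite sub0r normrN => /(le_lt_trans (ler_norm _)).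
by rewrite ltNge h1.
Unshelve. all: by end_near.
Qed.

End System.

Lemma finite_union_arcs_circle (R : realType) (W : set R[i]) :
  finite_union_arcs W -> W `<=` circle.
Proof. by move=> [s ->] z [p _ [t _ <-]]; exact: circle_expi. Qed.

Unset Implicit Arguments.
Theorem theorem30 (R : realType) (A : finType) (F : A -> mobius R) :
  ~ exists (W : A -> set R[i]) (S : set A^ω),
      [/\ interval_almost_cover W /\ compatible F W S,
          Q F W S < 1,
          mobius_number_system F (interval_shift F W S)
        & forall w, interval_shift F W S w ->
            \bigcap_(k in [set k | (0 < k)%N])
              closure (refined F W (prefix_word w k)) = [set Phi F w]].
Proof.
move=> [W [S [[[arcsW _] _] Q1 [subSg PhiSg onto _] capSg]]].
have WC a := finite_union_arcs_circle (arcsW a).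
have Sg0 : interval_shift F W S !=set0.
  have : circle (expi 0 : R[i]) by exact: circle_expi.
  by rewrite -onto => -[w Sw _]; exists w.
by have := Q_ge1 WC subSg Sg0 PhiSg capSg; rewrite leNgt Q1.
Qed.
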